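(* Let $s\in\mathbb{R}$, $0<p_2\le p_1<\infty$, $0<q\le\infty$ and $\varphi_1\in\mathcal{G}_{p_1}$. Let $A$ denote either $B$ or $F$; if $A=F$ and $0<q<\infty$, assume that there exist $\varepsilon_0>0$ and $c_0>0$ such that $t^{\varepsilon_0-d/p_1}\varphi_1(t)\le c_0\,r^{\varepsilon_0-d/p_1}\varphi_1(r)$ for all $t\ge r>0$. Then $$A_{p_1,q}^{s,\varphi_1}(\mathbb{R}^d)\hookrightarrow A_{p_2,q}^{s,\varphi_2}(\mathbb{R}^d)\qquad\text{with}\quad \varphi_2(t)=\varphi_1(t)\,t^{d(\frac1{p_2}-\frac1{p_1})},\ t>0.$$
   Context: $X\hookrightarrow Y$ means $X\subset Y$ with continuous natural embedding. $\mathcal{F}$ is the Fourier transform on $\mathcal{S}'(\mathbb{R}^d)$. Class $\mathcal{G}_p$ ($0<p<\infty$): all nondecreasing $\varphi:(0,\infty)\to(0,\infty)$ such that $t^{-d/p}\varphi(t)\ge s^{-d/p}\varphi(s)$ for all $0<t\le s<\infty$. $\mathcal{Q}$ is the set of dyadic cubes $2^{-j}([0,1)^d+k)$, $j\in\mathbb{Z}$, $k\in\mathbb{Z}^d$; $\ell(P)$ is the side length of $P$; $j_P=-\log_2\ell(P)$; $j_P\vee0=\max(j_P,0)$. Resolution of unity: $\theta_0\in\mathcal{S}(\mathbb{R}^d)$ with $\theta_0(x)=1$ for $|x|\le1$ and $\theta_0(x)=0$ for $|x|\ge3/2$; $\theta_k(x)=\theta_0(2^{-k}x)-\theta_0(2^{-k+1}x)$,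 $k\in\mathbb{N}$. For $0<p<\infty$ and $\varphi\in\mathcal{G}_p$ (in the $F$-case with $q<\infty$ also satisfying, for some $\varepsilon_0,c_0>0$, $t^{\varepsilon_0-d/p}\varphi(t)\le c_0 r^{\varepsilon_0-d/p}\varphi(r)$ for $t\ge r>0$), with $f_j=\mathcal{F}^{-1}(\theta_j\mathcal{F}f)$, the spaces consist of all $f\in\mathcal{S}'(\mathbb{R}^d)$ with finite quasi-norm (usual modification for $q=\infty$) $$\|f\mid B_{p,q}^{s,\varphi}(\mathbb{R}^d)\|=\sup_{P\in\mathcal{Q}}\frac1{\varphi(\ell(P))}\Big\{\sum_{j=j_P\vee0}^\infty\Big(\int_P|2^{js}f_j(x)|^p\,dx\Big)^{q/p}\Big\}^{1/q},$$ $$\|f\mid F_{p,q}^{s,\varphi}(\mathbb{R}^d)\|=\sup_{P\in\mathcal{Q}}\frac1{\varphi(\ell(P))}\Big\{\int_P\Big(\sum_{j=j_P\vee0}^\infty|2^{js}f_j(x)|^q\Big)^{p/q}dx\Big\}^{1/p}.$$ *)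

(* Defs.v *)
From HB Require Import structures.
From mathcomp Require Import all_boot all_order all_algebra.
From mathcomp Require Import complex.
From mathcomp Require Import all_classical all_reals all_analysis.

Set Implicit Arguments.
Unset Strict Implicit.
Unset Printing Implicit Defensive.

Import Order.TTheory GRing.Theory Num.Theory.
Import numFieldNormedType.Exports.

Local Open Scope classical_set_scope.
Local Open Scope ring_scope.

(* R^n is 'rV[R]_n.  Its sigma-algebra is generated by the coordinates, as the
   library does for n.-tuple; it is the Borel sigma-algebra of R^n. *)
Section rV_measurable.
Context {R : realType} (n : nat).

Let coord : 'I_n -> 'rV[R]_n -> measurableTypeR R := fun i x => x ord0 i.

Let coord_set0 : g_sigma_preimage coord set0.
Proof. exact: sigma_algebra0. Qed.

Let coord_setC A : g_sigma_preimage coord A -> g_sigma_preimage coord (~` A).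
Proof. exact: sigma_algebraC. Qed.

Let coord_bigcup (F : (set 'rV[R]_n)^nat) :
  (forall i, g_sigma_preimage coord (F i)) ->
  g_sigma_preimage coord (\bigcup_i F i).
Proof. exact: sigma_algebra_bigcup. Qed.

HB.instance Definition _ := @isMeasurable.Build
  (measure_tuple_display (R.-ocitv.-measurable).-sigma) 'rV[R]_n
  (g_sigma_preimage coord) coord_set0 coord_setC coord_bigcup.

End rV_measurable.

Section rV_measurable_fun.
Context {R : realType} (n : nat).

Lemma measurable_coord (i : 'I_n) :
  measurable_fun [set: 'rV[R]_n] (fun x => x ord0 i : measurableTypeR R).
Proof.
move=> _ Y mY; rewrite setTI; apply: sub_sigma_algebra => /=.
rewrite -bigcup_seq/=; exists i => /=; first by rewrite mem_index_enum.
by exists Y => //; rewrite setTI.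
Qed.

Lemma measurable_fun_rV d (T : measurableType d) (f : T -> 'rV[R]_n) :
  (forall i, measurable_fun setT (fun t => f t ord0 i : measurableTypeR R)) ->
  measurable_fun setT f.
Proof.
move=> mf; apply: (@measurability _ _ _ _ _ _ (\big[setU/set0]_(i < n)
    preimage_set_system setT (fun x : 'rV[R]_n => x ord0 i : measurableTypeR R)
    measurable)) => // _ [A + <-].
rewrite -bigcup_seq/= => -[i _ [B mB <-]].
have := mf i measurableT B mB.
by rewrite !setTI.
Qed.

End rV_measurable_fun.

(* Lebesgue measure on R^n.+1 is the image of the product of the Lebesgue
   measures of R and of R^n under (t, x) |-> (t, x_1, ..., x_n). *)
Section lebesgue_rV_step.
Local Open Scope ereal_scope.
Context {R : realType} (n : nat).

Definition rV_cons (tx : measurableTypeR R * 'rV[R]_n) : 'rV[R]_(1 + n) :=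
  row_mx (const_mx tx.1) tx.2.

Let rV_uncons (x : 'rV[R]_(1 + n)) : measurableTypeR R * 'rV[R]_n :=
  (x ord0 (lshift n ord0), rsubmx x).

Let measurable_cons : measurable_fun setT rV_cons.
Proof.
apply: measurable_fun_rV => i; rewrite -(splitK i);
  case: (fintype.split i) => j /=.
  by under eq_fun do rewrite row_mxEl mxE; exact: measurable_fst.
under eq_fun do rewrite row_mxEr.
by apply: (measurableT_comp (measurable_coord j)); exact: measurable_snd.
Qed.

Let measurable_uncons : measurable_fun setT rV_uncons.
Proof.
apply/measurable_fun_pairP; split; first exact: measurable_coord.
apply: measurable_fun_rV => i /=.
by under eq_fun do rewrite mxE; exact: measurable_coord.
Qed.

Let rV_uncons_consK : cancel rV_uncons rV_cons.
Proof.
move=> x; apply/rowP => i; rewrite -(splitK i);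
  case: (fintype.split i) => j /=.
  by rewrite row_mxEl mxE (ord1 j).
by rewrite row_mxEr mxE.
Qed.

Let rV_consK : cancel rV_cons rV_uncons.
Proof. by case=> t x; rewrite /rV_uncons /= row_mxEl mxE row_mxKr. Qed.

Variable m : {sigma_finite_measure set 'rV[R]_n -> \bar R}.

Definition lebesgue_rV_step : set 'rV[R]_(1 + n) -> \bar R :=
  pushforward (@lebesgue_measure R \x m) rV_cons.

Let step0 : lebesgue_rV_step set0 = 0.
Proof. by rewrite /lebesgue_rV_step/pushforward preimage_set0 measure0. Qed.

Let step_ge0 A : 0 <= lebesgue_rV_step A.
Proof. exact: measure_ge0. Qed.

Let step_sigma_additive : semi_sigma_additive lebesgue_rV_step.
Proof.
exact: (@measure_semi_sigma_additive _ _ _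
  (pushforward (@lebesgue_measure R \x m) rV_cons)).
Qed.

HB.instance Definition _ := isMeasure.Build _ _ _ lebesgue_rV_step
  step0 step_ge0 step_sigma_additive.

Let step_sigma_finite : sigma_finite setT lebesgue_rV_step.
Proof.
have /sigma_finiteP[F [FT ndF Foo]] := sigma_finiteT (@lebesgue_measure R).
have /sigma_finiteP[G [GT ndG Goo]] := sigma_finiteT m.
exists (fun k => rV_uncons @^-1` (F k `*` G k)).
  apply/seteqP; split => // x _.
  have [i _ Fi] : (\bigcup_i F i) (rV_uncons x).1 by rewrite -FT.
  have [j _ Gj] : (\bigcup_j G j) (rV_uncons x).2 by rewrite -GT.
  exists (maxn i j) => //; split.
    by move: Fi; exact/subsetPset/ndF/leq_maxl.
  by move: Gj; exact/subsetPset/ndG/leq_maxr.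
move=> k; have [mF Fk] := Foo k; have [mG Gk] := Goo k; split.
  by rewrite -[X in measurable X]setTI; apply: measurable_uncons => //;
    exact: measurableX.
rewrite /lebesgue_rV_step/pushforward -comp_preimage.
rewrite (_ : _ \o _ = id) ?preimage_id; last first.
  by apply/funext => x /=; rewrite rV_consK.
by rewrite product_measure1E// lte_mul_pinfty// ge0_fin_numE.
Qed.

HB.instance Definition _ := Measure_isSigmaFinite.Build _ _ _ lebesgue_rV_step
  step_sigma_finite.

End lebesgue_rV_step.

Fixpoint lebesgue_rV {R : realType} (n : nat) :
    {sigma_finite_measure set 'rV[R]_n -> \bar R} :=
  match n with
  | 0 => [the {sigma_finite_measure set _ -> \bar R} of \d_(0 : 'rV[R]_0)]
  | k.+1 => [the {sigma_finite_measure set _ -> \bar R} of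
              lebesgue_rV_step (lebesgue_rV k)]
  end.

Lemma lebesgue_rV_box {R : realType} (n : nat)
    (A : 'I_n -> set (measurableTypeR R)) : (forall i, measurable (A i)) ->
  lebesgue_rV n [set x | forall i, A i (x ord0 i)] =
  (\prod_(i < n) lebesgue_measure (A i))%E.
Proof.
elim: n A => [|n IHn] A mA.
  rewrite big_ord0 /= /dirac indicE mem_set//; by case.
have mbox :
    measurable [set x : 'rV[R]_n | forall i, A (lift ord0 i) (x ord0 i)].
  rewrite (_ : mkset _ = \bigcap_(i in [set: 'I_n])
      ((fun x : 'rV[R]_n => x ord0 i : measurableTypeR R) @^-1` A (lift ord0 i))).
    apply: fin_bigcap_measurable => // i _.
    by rewrite -[X in measurable X]setTI; exact: measurable_coord.
  by apply/seteqP; split => [x Ax i _|x Ax i]; exact: Ax.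
have cons0 (t : measurableTypeR R) (x : 'rV[R]_n) :
    rV_cons (t, x) ord0 ord0 = t.
  rewrite /rV_cons (_ : @ord0 n = lshift n (@ord0 0)); last exact/val_inj.
  by rewrite row_mxEl mxE.
have consS (t : measurableTypeR R) (x : 'rV[R]_n) (i : 'I_n) :
    rV_cons (t, x) ord0 (lift ord0 i) = x ord0 i.
  by rewrite /rV_cons (_ : lift ord0 i = rshift 1 i) ?row_mxEr//; exact/val_inj.
rewrite big_ord_recl -IHn// -product_measure1E//.
rewrite /= /lebesgue_rV_step/pushforward; congr product_measure1.
apply/seteqP; split => [[t x] Atx|[t x] [At Ax] i].
  split => [|i]; first by have := Atx ord0; rewrite cons0.
  by have := Atx (lift ord0 i); rewrite consS.
by case: (unliftP ord0 i) => [j ->|->]; rewrite ?consS ?cons0//; exact: Ax.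
Qed.

Section functions_on_rV.
Context {R : realType} {n : nat}.
Local Notation Rn := 'rV[R]_n.
Local Notation C := R[i].
Local Notation cRe := (@complex.Re R).
Local Notation cIm := (@complex.Im R).
Implicit Types (x xi : Rn) (psi theta : Rn -> C).

(* The library norm `|x| of a row vector is the maximum norm. *)
Definition enorm x : R := Num.sqrt (\sum_i x ord0 i ^+ 2).

Definition dotrV x xi : R := \sum_i x ord0 i * xi ord0 i.

Definition cabs (z : C) : R := ComplexField.Normc.normc z.

(* [:: i_1; ...; i_m] stands for the operator d/dx_{i_1} ... d/dx_{i_m}. *)
Definition partials (l : seq 'I_n) (f : Rn -> R) : Rn -> R :=
  foldr (fun i g x => 'D_(delta_mx ord0 i) g x) f l.

(* C^oo: all iterated partial derivatives are differentiable everywhere. *)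
Definition smooth (f : Rn -> R) :=
  forall l x, differentiable (partials l f) x.

Definition cpartials (l : seq 'I_n) psi : Rn -> C :=
  fun x =>
  (partials l (cRe \o psi) x +i* partials l (cIm \o psi) x)%C.

Definition csmooth psi :=
  smooth (cRe \o psi) /\ smooth (cIm \o psi).

Definition schwartz_norm (N : nat) psi : \bar R :=
  ereal_sup [set ((1 + enorm lx.2) ^+ N * cabs (cpartials lx.1 psi lx.2))%:E
            | lx in [set lx : seq 'I_n * Rn | (size lx.1 <= N)%N]].

Definition schwartz psi :=
  csmooth psi /\ forall N, (schwartz_norm N psi < +oo)%E.

Definition cintegral (f : Rn -> C) : C :=
  (Rintegral (lebesgue_rV n) setT (cRe \o f)
   +i* Rintegral (lebesgue_rV n) setT (cIm \o f))%C.

Definition cintegrable (f : Rn -> C) :=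
  (lebesgue_rV n).-integrable setT (EFin \o (cRe \o f)) /\
  (lebesgue_rV n).-integrable setT (EFin \o (cIm \o f)).

Definition cis (t : R) : C := (cos t +i* sin t)%C.

Definition fourier psi : Rn -> C := fun xi =>
  ((2 * pi) `^ (- (n%:R / 2)))%:C%C *
  cintegral (fun x => cis (- dotrV x xi) * psi x).

Definition inv_fourier psi : Rn -> C := fun x =>
  ((2 * pi) `^ (- (n%:R / 2)))%:C%C *
  cintegral (fun xi => cis (dotrV x xi) * psi xi).

(* A tempered distribution is represented by a functional on all functions
   R^n -> C of which only the values on Schwartz functions are used; on these
   it is linear, and continuous for the topology of the norms
   schwartz_norm N, N = 0, 1, 2, ... (which increase with N). *)
Definition distribution := (Rn -> C) -> C.
Implicit Types u : distribution.

Definition tempered u :=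
  (forall (a : C) psi chi, schwartz psi -> schwartz chi ->
     u (fun x => a * psi x + chi x) = a * u psi + u chi) /\
  (forall psi, schwartz psi -> forall e : R, 0 < e ->
     exists N, exists2 d : R, 0 < d &
       forall chi, schwartz chi ->
         (schwartz_norm N (fun x => chi x - psi x)%R < d%:E)%E ->
         cabs (u chi - u psi) < e).

Definition dist_fourier u : distribution := fun psi => u (fourier psi).
Definition dist_inv_fourier u : distribution := fun psi => u (inv_fourier psi).
Definition dist_mul theta u : distribution :=
  fun psi => u (fun x => theta x * psi x).
Definition dist_sub u v : distribution := fun psi => u psi - v psi.

Definition represents u (g : Rn -> C) :=
  [/\ continuous (cRe \o g), continuous (cIm \o g) &
      forall psi, schwartz psi ->
        cintegrable (fun x => g x * psi x) /\
        u psi = cintegral (fun x => g x * psi x)].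

(* The continuous function equal to the distribution u.  It is unique, and it
   exists for every tempered u with compactly supported Fourier transform
   (Paley-Wiener-Schwartz), the only case in which it is used below; the
   default value 0 then plays no role. *)
Definition dist_fun u : Rn -> C := xget (fun=> 0) [set g | represents u g].

Definition resolution_generator (theta0 : Rn -> C) :=
  [/\ schwartz theta0,
      forall x, enorm x <= 1 -> theta0 x = 1 &
      forall x, 3 / 2 <= enorm x -> theta0 x = 0].

Definition resolution (theta0 : Rn -> C) (k : nat) : Rn -> C := fun x =>
  if k is k'.+1 then theta0 ((2 : R) ^- k *: x) - theta0 ((2 : R) ^- k' *: x)
  else theta0 x.

Definition lp_block (theta0 : Rn -> C) u (j : nat) : Rn -> C :=
  dist_fun (dist_inv_fourier (dist_mul (resolution theta0 j) (dist_fourier u))).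

Definition dyadic_side (j : int) : R := 2 ^ (- j).

Definition dyadic_cube (j : int) (k : 'rV[int]_n) : set Rn :=
  [set dyadic_side j *: (x + map_mx intr k)
  | x in [set x : Rn | forall i, 0 <= x ord0 i < 1]].

End functions_on_rV.

Inductive space_type := BType | FType.

Section spaces.
Context {R : realType} (n : nat).
Local Notation Rn := 'rV[R]_n.
Local Notation C := R[i].
Implicit Types (phi : R -> R) (p s : R) (q : \bar R).

Definition class_G p phi :=
  [/\ forall t : R, 0 < t -> 0 < phi t,
      forall t r : R, 0 < t -> t <= r -> phi t <= phi r &
      forall t r : R, 0 < t -> t <= r ->
        r `^ (- (n%:R / p)) * phi r <= t `^ (- (n%:R / p)) * phi t].

Definition growth_condition p phi :=
  exists eps0 c0 : R, [/\ 0 < eps0, 0 < c0 &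
    forall t r : R, 0 < r -> r <= t ->
      t `^ (eps0 - n%:R / p) * phi t <= c0 * (r `^ (eps0 - n%:R / p) * phi r)].

Definition admissible (A : space_type) p q phi :=
  class_G p phi /\ (A = FType -> (q < +oo)%E -> growth_condition p phi).

Section quasi_norms.
Local Open Scope ereal_scope.
Variables (theta0 : Rn -> C) (s p : R) (q : \bar R) (phi : R -> R).
Variable f : @distribution R n.

Let block (j : nat) (x : Rn) : R :=
  cabs ((2 `^ (j%:R * s))%:C%C * lp_block theta0 f j x)%R.

(* j_P \vee 0 for a dyadic cube P of generation j *)
Let start (j : int) : nat := `|Num.max j 0|%N.

(* The parameter q ranges over ]0, +oo]; the other values are irrelevant. *)
Definition B_norm : \bar R :=
  ereal_sup (range (fun jk : int * 'rV[int]_n =>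
    let P := dyadic_cube jk.1 jk.2 in
    (phi (dyadic_side jk.1))^-1%:E *
    match q with
    | r%:E =>
        (\sum_(start jk.1 <= j <oo)
          (\int[lebesgue_rV n]_(x in P) ((block j x) `^ p)%:E) `^ (r / p))
        `^ r^-1
    | _ =>
        ereal_sup [set (\int[lebesgue_rV n]_(x in P) ((block j x) `^ p)%:E)
                       `^ p^-1
                  | j in [set j | (start jk.1 <= j)%N]]
    end)).

Definition F_norm : \bar R :=
  ereal_sup (range (fun jk : int * 'rV[int]_n =>
    let P := dyadic_cube jk.1 jk.2 in
    (phi (dyadic_side jk.1))^-1%:E *
    match q with
    | r%:E =>
        (\int[lebesgue_rV n]_(x in P)
          (\sum_(start jk.1 <= j <oo) ((block j x) `^ r)%:E) `^ (p / r))
        `^ p^-1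
    | _ =>
        (\int[lebesgue_rV n]_(x in P)
          (ereal_sup [set (block j x)%:E
                     | j in [set j | (start jk.1 <= j)%N]]) `^ p)
        `^ p^-1
    end)).

End quasi_norms.

Definition A_norm (A : space_type) :=
  match A with BType => B_norm | FType => F_norm end.

Definition A_space (A : space_type) theta0 s p q phi : set (@distribution R n) :=
  [set f | tempered f /\ (A_norm A theta0 s p q phi f < +oo)%E].

(* X \subset Y, and the inclusion is continuous for the topologies of the
   quasi-norms normX of X and normY of Y. *)
Definition continuous_embedding (X Y : set (@distribution R n))
    (normX normY : @distribution R n -> \bar R) :=
  X `<=` Y /\
  forall f, X f -> forall e : R, 0 < e -> exists2 d : R, 0 < d &
    forall g, X g -> (normX (dist_sub g f) < d%:E)%E ->
      (normY (dist_sub g f) < e%:E)%E.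

End spaces.

(* Main.v *)
Require Import Defs.
From HB Require Import structures.
From mathcomp Require Import all_boot all_order all_algebra.
From mathcomp Require Import complex.
From mathcomp Require Import all_classical all_reals all_analysis.

(** The embedding is Hoelder's inequality on each dyadic cube.  A dyadic cube P
    of side t has measure t^n, so for every nonnegative f the averaging
    inequality [power_mean_le] between the exponents p2 <= p1 reads
      (\int_P f^p2)^(1/p2) <= t^(n (1/p2 - 1/p1)) (\int_P f^p1)^(1/p1),
    and t^(n (1/p2 - 1/p1)) is exactly the quotient phi2(t) / phi1(t).  For F
    this is applied once per cube, to the l^q norm in j of the blocks; for B it
    is applied to each block, and the factor, which does not depend on j, is
    pulled out of the l^q norm ([lr_norm_le_scale]).  Both quasi-norms therefore
    decrease, with constant 1 ([B_norm_le], [F_norm_le]), and the inclusion is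
    continuous because these estimates hold for every distribution, hence for
    differences.

    The averaging inequality holds for arbitrary nonnegative integrands, with
    values in [0, +oo]: their integral is by definition a supremum over the
    simple functions below them, and Hoelder's inequality for simple functions
    passes to this supremum.  It thus applies at once to the blocks and to their
    l^q norms, whichever functions represent the blocks. *)

Set Implicit Arguments.
Unset Strict Implicit.
Unset Printing Implicit Defensive.

Import Order.TTheory GRing.Theory Num.Theory.
Import numFieldNormedType.Exports.

Local Open Scope classical_set_scope.
Local Open Scope ring_scope.

(** * Hoelder's inequality for nonmeasurable integrands *)

Section lower_integral.
Context d (T : measurableType d) (R : realType).
Variable mu : {measure set T -> \bar R}.
Implicit Type D : set T.
Local Open Scope ereal_scope.
Implicit Types f g : T -> \bar R.

Import HBNNSimple.

Lemma ge0_le_lower_integral D f g : (forall x, D x -> 0 <= f x) ->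
  (forall x, D x -> f x <= g x) ->
  \int[mu]_(x in D) f x <= \int[mu]_(x in D) g x.
Proof.
move=> f0 fg.
rewrite !ge0_integralE//; last first.
  by move=> x Dx; exact: le_trans (f0 _ Dx) (fg _ Dx).
by apply: ereal_sup_le => _ [h /= hf <-]; exists h => //= x;
  rewrite (le_trans (hf x))//; apply: lee_restrict.
Qed.

Lemma ge0_lower_integral_le D f (M : \bar R) : (forall x, D x -> 0 <= f x) ->
  (forall h : {nnsfun T >-> R}, (forall x, (h x)%:E <= (f \_ D) x) ->
     \int[mu]_x (h x)%:E <= M) ->
  \int[mu]_(x in D) f x <= M.
Proof.
move=> f0 hM; rewrite ge0_integralE//; apply: ge_ereal_sup => _ [h /= hf <-].
by have := hM h hf; rewrite integral_nnsfun// patch_setT.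
Qed.

(** A simple function h below f, restricted to D, vanishes off D; hence
    h = h * 1_D, and Hoelder applied to this product gives the power of mu D. *)
Lemma hoelder_lower_integral D f r : measurable D -> (1 < r)%R ->
  (forall x, D x -> 0 <= f x) ->
  \int[mu]_(x in D) f x <=
    mu D `^ (1 - r^-1)%R * (\int[mu]_(x in D) f x `^ r) `^ r^-1.
Proof.
move=> mD r1 f0; have r0 : (0 < r)%R by exact: lt_trans r1.
have r1V : (0 < 1 - r^-1)%R by rewrite subr_gt0 invf_lt1.
apply: ge0_lower_integral_le => // h hf.
have hD x : h x = (h x * \1_D x)%R.
  rewrite indicE; have := hf x; rewrite patchE.
  case: ifPn => [_ _|_]; first by rewrite mulr1.
  rewrite lee_fin mulr0 => hx0; apply/eqP; rewrite eq_le hx0/=.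
  exact: fun_ge0.
have -> : \int[mu]_x (h x)%:E = Lnorm mu 1 (EFin \o (h \* \1_D)%R).
  rewrite Lnorm1; apply: eq_integral => x _ /=.
  by rewrite -hD ger0_norm//; exact: fun_ge0.
have := @hoelder _ _ _ mu h (\1_D) r (1 - r^-1)^-1%R.
move=> /(_ _ _ r0); rewrite invr_gt0 => /(_ _ _ r1V).
rewrite invrK subrKC => /(_ _ _ erefl).
move=> /(_ _ _)/le_trans; apply => //.
rewrite muleC lee_pmul ?Lnorm_ge0//.
  rewrite unlock invrK.
  rewrite (_ : \int[mu]_x _ = mu D)//.
  rewrite -[in RHS](setIT D) -integral_indic//; apply: eq_integral => x _ /=.
  rewrite indicE; case: (x \in D); first by rewrite normr1 powR1.
  by rewrite normr0 powR0// gt_eqF// invr_gt0.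
rewrite unlock gt0_ler_poweR ?invr_ge0 ?(ltW r0)//.
- by rewrite in_itv/= leey andbT integral_ge0// => x _; exact: poweR_ge0.
- by rewrite in_itv/= leey andbT integral_ge0// => x _; exact: poweR_ge0.
rewrite [leRHS]integral_mkcond; apply: ge0_le_lower_integral => x _.
  exact: poweR_ge0.
have := hf x; rewrite /= !patchE ger0_norm; last exact: fun_ge0.
case: ifPn => [/set_mem Dx hfx|_].
  rewrite -poweR_EFin; apply: (gt0_ler_poweR (ltW r0)) => //;
    rewrite in_itv/= ?leey ?andbT ?f0//.
  by rewrite lee_fin fun_ge0.
rewrite lee_fin => hx0; rewrite (_ : h x = 0%R) ?powR0 ?gt_eqF//.
by apply/eqP; rewrite eq_le hx0/=; exact: fun_ge0.
Qed.

(** Hoelder with exponent p1 / p2, applied to f^p2.  The case p1 = p2 is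
    separate because the conjugate exponent is then infinite. *)
Lemma power_mean_le D f p1 p2 : measurable D -> (0 < p2)%R -> (p2 <= p1)%R ->
  (forall x, D x -> 0 <= f x) ->
  (\int[mu]_(x in D) f x `^ p2) `^ p2^-1 <=
    mu D `^ (p2^-1 - p1^-1)%R * (\int[mu]_(x in D) f x `^ p1) `^ p1^-1.
Proof.
move=> mD p20 + f0; rewrite le_eqVlt => /predU1P[<-|p21].
  by rewrite subrr poweRe0 mul1e.
have p10 : (0 < p1)%R by exact: lt_trans p21.
have r1 : (1 < p1 / p2)%R by rewrite ltr_pdivlMr// mul1r.
have := @hoelder_lower_integral D (fun x => f x `^ p2) _ mD r1
  (fun x _ => poweR_ge0 _ _).
under [X in _ * X `^ _]eq_integral do
  rewrite -poweRrM mulrCA divff ?gt_eqF// mulr1.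
have i0 p : 0 <= \int[mu]_(x in D) f x `^ p.
  by apply: integral_ge0 => x _; exact: poweR_ge0.
have p2V : (0 <= p2^-1)%R by rewrite invr_ge0 ltW.
move=> /(gt0_ler_poweR p2V) => /(_ _ _)/le_trans; apply.
- by rewrite in_itv/= leey i0.
- by rewrite in_itv/= leey mule_ge0 ?poweR_ge0.
rewrite poweRM ?poweR_ge0// -!poweRrM mulrBl mul1r invf_div.
by rewrite mulrAC divff ?gt_eqF// mul1r.
Qed.

End lower_integral.

(** * Dyadic cubes *)

Section dyadic_cubes.
Context {R : realType} (n : nat).

Lemma dyadic_side_gt0 (j : int) : 0 < dyadic_side j :> R.
Proof. exact: exprz_gt0. Qed.

Let side (j : int) (m : int) : set (measurableTypeR R) :=
  `[dyadic_side j * m%:~R, dyadic_side j * (1 + m%:~R)[%classic.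

Lemma dyadic_cubeE (j : int) (k : 'rV[int]_n) :
  dyadic_cube j k =
  [set x : 'rV[R]_n | forall i, side j (k ord0 i) (x ord0 i)].
Proof.
have t0 := dyadic_side_gt0 j.
apply/seteqP; split => [_ [y y01 <-] i|x xk].
  rewrite /side/= in_itv/= !mxE ler_pM2l// ltr_pM2l// lerDr ltrD2r.
  exact: y01.
exists ((dyadic_side j)^-1 *: x - map_mx intr k) => [i|]; last first.
  by rewrite subrK scalerA divff ?gt_eqF// scale1r.
have := xk i; rewrite /side/= in_itv/= !mxE subr_ge0 ltrBlDr.
by rewrite ler_pdivlMl// ltr_pdivrMl.
Qed.

Lemma measurable_dyadic_cube (j : int) (k : 'rV[int]_n) :
  measurable (dyadic_cube j k : set 'rV[R]_n).
Proof.
rewrite dyadic_cubeE (_ : mkset _ = \bigcap_(i in [set: 'I_n])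
    ((fun x : 'rV[R]_n => x ord0 i : measurableTypeR R) @^-1`
      side j (k ord0 i))).
  apply: fin_bigcap_measurable => // i _.
  rewrite -[X in measurable X]setTI; apply: measurable_coord => //.
  exact: measurable_itv.
by apply/seteqP; split => [x Ax i _|x Ax i]; exact: Ax.
Qed.

Lemma lebesgue_dyadic_cube (j : int) (k : 'rV[int]_n) :
  lebesgue_rV n (dyadic_cube j k) = (dyadic_side j ^+ n : R)%:E.
Proof.
have t0 := dyadic_side_gt0 j.
rewrite dyadic_cubeE (@lebesgue_rV_box _ _ (fun i => side j (k ord0 i)));
  last by move=> i; exact: measurable_itv.
rewrite (eq_bigr (fun=> (dyadic_side j : R)%:E)) => [|i _].
  by rewrite prodEFin prodr_const card_ord.
rewrite /side lebesgue_measure_itv/= lte_fin ltr_pM2l// ltrDr ltr01.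
by rewrite -EFinB mulrDr mulr1 addrK.
Qed.

Lemma lebesgue_dyadic_cube_powR (j : int) (k : 'rV[int]_n) (a : R) :
  (lebesgue_rV n (dyadic_cube j k) `^ a = (dyadic_side j `^ (n%:R * a))%:E)%E.
Proof.
rewrite lebesgue_dyadic_cube poweR_EFin powRrM powR_mulrn//.
exact/ltW/dyadic_side_gt0.
Qed.

End dyadic_cubes.

(** * Comparison of the quasi-norms *)

(** Monotonicity and homogeneity of the l^r quasi-norm in one step, for any
    r > 0; the entries are extended reals because they will be local integrals
    of blocks, which may be infinite. *)
Lemma lr_norm_le_scale (R : realType) (u v : (\bar R)^nat) (m : nat) (t r : R) :
  0 < r -> 0 <= t -> (forall i, 0 <= u i)%E -> (forall i, 0 <= v i)%E ->
  (forall i, u i <= t%:E * v i)%E ->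
  ((\sum_(m <= i <oo) u i `^ r) `^ r^-1 <=
     t%:E * (\sum_(m <= i <oo) v i `^ r) `^ r^-1)%E.
Proof.
move=> r0 t0 u0 v0 uv.
have nneg_itv (x : \bar R) : (0 <= x -> x \in `[0, +oo])%E.
  by move=> x0; rewrite in_itv/= x0 leey.
have tE : (t%:E = (t `^ r)%:E `^ r^-1)%E.
  by rewrite poweR_EFin -powRrM divff ?gt_eqF// powRr1.
have S0 (w : (\bar R)^nat) : (0 <= \sum_(m <= i <oo) w i `^ r)%E.
  by apply: nneseries_ge0 => i _ _; exact: poweR_ge0.
rewrite [in leRHS]tE -poweRM ?lee_fin ?powR_ge0//.
rewrite gt0_ler_poweR ?invr_ge0 ?(ltW r0)// ?nneg_itv ?mule_ge0 ?lee_fin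
  ?powR_ge0//.
rewrite -nneseriesZl => [|i _]; last exact: poweR_ge0.
apply: lee_nneseries => [i _ _|i _]; first exact: poweR_ge0.
rewrite -poweR_EFin -poweRM ?lee_fin//.
by rewrite gt0_ler_poweR ?(ltW r0)// ?nneg_itv ?mule_ge0 ?lee_fin.
Qed.

Lemma cabs_ge0 (R : realType) (z : R[i]) : 0 <= cabs z.
Proof. by case: z => x y; exact: sqrtr_ge0. Qed.

Section space_comparison.
Context {R : realType} (n : nat).
Variables (theta0 : 'rV[R]_n -> R[i]) (s p1 p2 : R) (phi1 : R -> R).
Hypotheses (p2_gt0 : 0 < p2) (p2_le_p1 : p2 <= p1).

Let a := n%:R * (p2^-1 - p1^-1).
Let phi2 := fun t => phi1 t * t `^ a.
Let p1_gt0 : 0 < p1 := lt_le_trans p2_gt0 p2_le_p1.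

Let a_ge0 : 0 <= a.
Proof. by rewrite mulr_ge0// subr_ge0 lef_pV2. Qed.

(** The factor in phi2 compensates the change of the exponent n/p, so the two
    conditions on phi1 that involve n/p1 become those on phi2 with n/p2. *)
Lemma powR_mul_phi2 (e t : R) : 0 < t ->
  t `^ (e - n%:R / p2) * phi2 t = t `^ (e - n%:R / p1) * phi1 t.
Proof.
move=> t0; rewrite mulrCA -powRD; last first.
  by rewrite (gt_eqF t0) implybT.
by rewrite mulrC /a mulrBr addrA subrK.
Qed.

Lemma admissible_phi2 A q :
  admissible n A p1 q phi1 -> admissible n A p2 q phi2.
Proof.
move=> [[phi1_gt0 phi1_nd phi1_ni] phi1F]; split; last first.
  move=> AF qoo; have [e [c [e0 c0 ec]]] := phi1F AF qoo.
  exists e, c; split => // t r r0 rt.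
  by rewrite (powR_mul_phi2 _ r0) (powR_mul_phi2 _ (lt_le_trans r0 rt)) ec.
split=> [t t0|t r t0 tr|t r t0 tr].
- by rewrite mulr_gt0 ?phi1_gt0 ?powR_gt0.
- have r0 := lt_le_trans t0 tr.
  apply: ler_pM; [exact/ltW/phi1_gt0|exact: powR_ge0|exact: phi1_nd|].
  by apply: ge0_ler_powR => //; rewrite nnegrE ltW.
- have := powR_mul_phi2 0 t0; have := powR_mul_phi2 0 (lt_le_trans t0 tr).
  by rewrite !sub0r => -> ->; exact: phi1_ni.
Qed.

Local Open Scope ereal_scope.

Lemma power_mean_cube (f : 'rV[R]_n -> \bar R) (j : int) (k : 'rV[int]_n) :
  (forall x, 0 <= f x) ->
  (\int[lebesgue_rV n]_(x in dyadic_cube j k) f x `^ p2) `^ p2^-1 <=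
  (dyadic_side j `^ a)%:E *
    (\int[lebesgue_rV n]_(x in dyadic_cube j k) f x `^ p1) `^ p1^-1.
Proof.
move=> f0; rewrite -(lebesgue_dyadic_cube_powR _ k).
by apply: power_mean_le => //; exact: measurable_dyadic_cube.
Qed.

Lemma cube_weight (j : int) (X Y : \bar R) :
  (forall t : R, 0 < t -> 0 < phi1 t)%R ->
  X <= (dyadic_side j `^ a)%:E * Y ->
  (phi2 (dyadic_side j))^-1%:E * X <= (phi1 (dyadic_side j))^-1%:E * Y.
Proof.
move=> phi1_gt0 XY; have t0 := @dyadic_side_gt0 R j.
have w0 := powR_gt0 a t0.
apply: le_trans (lee_wpmul2l _ XY) _.
  by rewrite lee_fin invr_ge0 mulr_ge0 ?powR_ge0// ltW// phi1_gt0.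
by rewrite muleA -EFinM /phi2 invfM -mulrA mulVf ?gt_eqF// mulr1.
Qed.

Lemma B_norm_le q f : (forall t : R, 0 < t -> 0 < phi1 t)%R -> 0 < q ->
  B_norm theta0 s p2 q phi2 f <= B_norm theta0 s p1 q phi1 f.
Proof.
move=> phi1_gt0 q0; apply: ge_ereal_sup => _ [[j k] _ <-] /=.
set P := dyadic_cube j k.
set b := fun (i : nat) x =>
  cabs ((2 `^ (i%:R * s))%:C%C * lp_block theta0 f i x)%R.
have b0 i x : (0 <= b i x)%R by exact: cabs_ge0.
pose I (p : R) i := \int[lebesgue_rV n]_(x in P) ((b i x) `^ p)%:E.
have IE (p r : R) i : I p i `^ (r / p) = (I p i `^ p^-1) `^ r.
  by rewrite mulrC poweRrM.
have Ile i : I p2 i `^ p2^-1 <= (dyadic_side j `^ a)%:E * I p1 i `^ p1^-1.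
  by apply: (@power_mean_cube (fun x => (b i x)%:E)) => x; rewrite lee_fin.
apply: le_trans; last by apply: ereal_sup_ubound; exists (j, k).
rewrite -/P -/b; apply: cube_weight => //.
case: q q0 => [r|_|//]; last first.
  apply: ge_ereal_sup => _ [i /= ji <-]; apply: le_trans (Ile i) _.
  apply: lee_wpmul2l; first by rewrite lee_fin powR_ge0.
  by apply: ereal_sup_ubound; exists i.
rewrite lte_fin => r0.
under eq_eseriesr do rewrite [X in X `^ _]/= IE.
under [X in _ * X `^ _]eq_eseriesr do rewrite IE.
apply: lr_norm_le_scale => // [|i|i]; [exact: powR_ge0|exact: poweR_ge0|].
exact: poweR_ge0.
Qed.

Lemma F_norm_le q f : (forall t : R, 0 < t -> 0 < phi1 t)%R -> 0 < q ->
  F_norm theta0 s p2 q phi2 f <= F_norm theta0 s p1 q phi1 f.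
Proof.
move=> phi1_gt0 q0; apply: ge_ereal_sup => _ [[j k] _ <-] /=.
set P := dyadic_cube j k.
set b := fun (i : nat) x =>
  cabs ((2 `^ (i%:R * s))%:C%C * lp_block theta0 f i x)%R.
have b0 i x : (0 <= b i x)%R by exact: cabs_ge0.
apply: le_trans; last by apply: ereal_sup_ubound; exists (j, k).
rewrite -/P -/b; apply: cube_weight => //.
case: q q0 => [r|_|//]; last first.
  apply: power_mean_cube => x.
  apply: le_ereal_sup_tmp; exists (b `|Num.max j 0|%N x)%:E; last first.
    by rewrite lee_fin.
  by exists `|Num.max j 0|%N => /=.
rewrite lte_fin => r0.
(* The l^r norm of the blocks; its p-th power is the integrand. *)
pose F x := (\sum_(`|Num.max j 0|%N <= i <oo) ((b i x) `^ r)%:E) `^ r^-1.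
have FE (p : R) : \int[lebesgue_rV n]_(x in P)
  (\sum_(`|Num.max j 0|%N <= i <oo) ((b i x) `^ r)%:E) `^ (p / r) =
  \int[lebesgue_rV n]_(x in P) F x `^ p.
  by apply: eq_integral => x _; rewrite mulrC poweRrM.
rewrite !FE; apply: power_mean_cube => x; exact: poweR_ge0.
Qed.

End space_comparison.

Theorem proposition4p20 (R : realType) (d : nat) (d_gt0 : (0 < d)%N)
    (theta0 : 'rV[R]_d -> R[i]) (theta0P : resolution_generator theta0)
    (A : space_type) (s p1 p2 : R) (q : \bar R) (phi1 : R -> R)
    (p2_gt0 : 0 < p2) (p2_le_p1 : p2 <= p1) (q_gt0 : (0 < q)%E)
    (phi1_G : class_G d p1 phi1)
    (phi1_F : A = FType -> (q < +oo)%E -> growth_condition d p1 phi1) :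
  let phi2 := fun t : R => phi1 t * t `^ (d%:R * (p2^-1 - p1^-1)) in
  admissible d A p2 q phi2 /\
  continuous_embedding
    (A_space A theta0 s p1 q phi1) (A_space A theta0 s p2 q phi2)
    (A_norm A theta0 s p1 q phi1) (A_norm A theta0 s p2 q phi2).
Proof.
move=> phi2; split; first exact: admissible_phi2.
have norm_le f :
    (A_norm A theta0 s p2 q phi2 f <= A_norm A theta0 s p1 q phi1 f)%E.
  have [phi1_gt0 _ _] := phi1_G.
  by case: A {phi1_F}; [exact: B_norm_le|exact: F_norm_le].
split=> [f [f_tempered f_fin]|f _ e e0].
  by split=> //; exact: le_lt_trans (norm_le f) f_fin.
by exists e => // g _; exact: le_lt_trans (norm_le _).
Qed.
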